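(* Let $k$ be an infinite field, $S=k[x_1,\ldots,x_n]$ with the standard grading and the graded reverse lexicographic order with $x_1>x_2>\cdots>x_n$. Let $P$ be a homogeneous prime ideal of $S$ and let $J=\operatorname{in}(P)$ be its initial ideal. Assume that $J$ is of Borel type and that, for some $1\le r\le n-1$ and some monomial $u\in \Pi_r(J):\mathfrak{m}(r)$ with $u\notin \Pi_r(J)$, one has $\overline{\Phi_r}(J)=\Pi_r(J)+(u)$ as ideals of $S(r)=k[x_1,\ldots,x_r]$. Then: (1) Either $u=1$ and $(x_1,\ldots,x_r)\subset J$, or $J$ is generated by $J\cap k[x_1,\ldots,x_r]$ and one extra monomial generator $v$. (2) If $u\neq 1$, then the extra generator is $v=ux_{r+1}^e$ for some $e>0$. (3) If $u\neq 1$, then $J$ is generated by monomials inside $k[x_1,\ldots,x_{r+1}]$.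
   Context: For a nonzero $f\in S$, $\operatorname{in}(f)$ is the largest monomial occurring in $f$ with nonzero coefficient, and $\operatorname{in}(I)=(\operatorname{in}(f)\mid 0\ne f\in I)$. A monomial ideal $J$ is of Borel type if for any $i<j$ and any monomial $u\in J$ divisible by $x_j$ there is an integer $t\ge 0$ with $x_i^tu/x_j\in J$ (equivalently $J:(x_1,\ldots,x_i)^\infty=J:x_i^\infty$ for all $i$). $S(r)=k[x_1,\ldots,x_r]$ and $\mathfrak{m}(r)=(x_1,\ldots,x_r)\subset S(r)$. The map $\Pi_r:S\to S(r)$ is the $k$-algebra map fixing $x_1,\ldots,x_r$ and sending $x_{r+1},\ldots,x_n$ to $0$; $\Pi_r(J)$ is the image ideal in $S(r)$. For a monomial $w=x_1^{a_1}\cdots x_n^{a_n}$ put $\Phi_r(w)=x_1^{a_1}\cdots x_r^{a_r}$. For a monomial ideal $J$ with minimal monomial generators $u_1,\ldots,u_m$, $\Phi_r(J)=(\Phi_r(u_1),\ldots,\Phi_r(u_m))S=J:(x_{r+1}\cdots x_n)^\infty$, and $\overline{\Phi_r}(J)=\Pi_r(\Phi_r(J))$ is the ideal of $S(r)$ generated by the same monomials $\Phi_r(u_1),\ldots,\Phi_r(u_m)$. *)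

(* Defs.v *)
From mathcomp Require Import all_boot all_order all_algebra.
From mathcomp Require Import boolp classical_sets cardinality.
From mathcomp Require Import mpoly.

Set Implicit Arguments.
Unset Strict Implicit.
Unset Printing Implicit Defensive.

Import GRing.Theory.
Local Open Scope ring_scope.
Local Open Scope classical_set_scope.

(* The variable x_i is ['X_j] for the ordinal [j] of value [i - 1].  Ideals are
   [set]s of polynomials, and a monomial is its exponent vector ['X_{1..n}], so
   the monomial 1 is [0%MM]. *)

Section Ideals.
Variable R : comNzRingType.
Implicit Types A I K : set R.

(* [idealr_closed] includes properness: 1 is not in P. *)
Definition prime_ideal (P : set R) : Prop :=
  idealr_closed (mem P) /\ prime_idealr_closed (mem P).

Definition ideal_gen A : set R :=
  [set f | exists2 s : seq (R * R), {in s, forall c, A c.2} &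
                                    f = \sum_(c <- s) c.1 * c.2].

Definition ideal_add I K : set R := [set f + g | f in I & g in K].

Definition ideal_colon I K : set R := [set f | forall g, K g -> I (f * g)].

End Ideals.

(* Graded reverse lexicographic order with x_1 > ... > x_n; the library order
   on ['X_{1..n}] is graded lexicographic (see [ltmcP]), despite the header of
   mpoly. *)
Definition grevlex_lt n (m1 m2 : 'X_{1..n}) : bool :=
  (mdeg m1 < mdeg m2)%N ||
  (mdeg m1 == mdeg m2) &&
    [exists i : 'I_n, (m2 i < m1 i)%N &&
                      [forall j : 'I_n, (i < j)%N ==> (m1 j == m2 j)]].

Section Polynomials.
Variables (k : fieldType) (n : nat).
Local Notation S := {mpoly k[n]}.
Implicit Types (f : S) (I J : set S) (m v : 'X_{1..n}) (r : nat).

Definition homogeneous_ideal I : Prop :=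
  forall f d, I f -> I (pihomog mdeg d f).

Definition is_initial_monomial f m : Prop :=
  m \in msupp f /\ {in msupp f, forall m', m' != m -> grevlex_lt m' m}.

Definition initial_ideal I : set S :=
  ideal_gen [set 'X_[m] | m in
    [set m | exists f, [/\ I f, f != 0 & is_initial_monomial f m]]].

Definition borel_type J : Prop :=
  forall (i j : 'I_n) m, (i < j)%N -> J 'X_[m] -> (0 < m j)%N ->
    exists t : nat, J 'X_[m - U_(j) + U_(i) *+ t].

Definition min_gens J : set 'X_{1..n} :=
  [set m | J 'X_[m] /\
           forall m', J 'X_[m'] -> (m' <= m)%MM -> m' = m].

Definition trunc_vars r f : {mpoly k[r]} :=
  f \mPo [tuple (if insub (i : nat) is Some j then 'X_j else 0) | i < n].

Definition Pi r J : set {mpoly k[r]} := trunc_vars r @` J.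

Definition Phi_mnm r m : 'X_{1..n} :=
  [multinom (if (i < r)%N then m i else 0%N) | i < n].

Definition Phi r J : set S :=
  ideal_gen [set 'X_[Phi_mnm r m] | m in min_gens J].

Definition Phibar r J : set {mpoly k[r]} := @Pi r (Phi r J).

Definition irrelevant_ideal : set S := ideal_gen [set 'X_i | i in [set: 'I_n]].

(* The ideal (x_1, ..., x_r) of S. *)
Definition first_vars_ideal r : set S :=
  ideal_gen [set 'X_i | i in [set i : 'I_n | (i < r)%N]].

Definition mnm_in_first_vars r m : Prop :=
  forall i : 'I_n, (r <= i)%N -> m i = 0%N.

(* The subring k[x_1, ..., x_r] of S. *)
Definition first_vars_subring r : set S :=
  [set f | {in msupp f, forall m, mnm_in_first_vars r m}].

(* J is generated by J `&` k[x_1, ..., x_r] and v, and v is not redundant. *)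
Definition extra_generator J r v : Prop :=
  J = ideal_gen ((J `&` first_vars_subring r) `|` [set 'X_[v]]) /\
  ~ ideal_gen (J `&` first_vars_subring r) 'X_[v].

(* A monomial of S(r), seen in S. *)
Definition mnm_embed r (u : 'X_{1..r}) : 'X_{1..n} :=
  [multinom (if insub (i : nat) is Some j then u j else 0%N) | i < n].

End Polynomials.

Arguments Pi {k n} r J _.
Arguments Phibar {k n} r J _.
Arguments irrelevant_ideal k n _ : clear implicits.
Arguments first_vars_ideal k n r _ : clear implicits.
Arguments mnm_embed n {r} u.

(* Main.v *)
Require Import Defs.
From mathcomp Require Import all_boot all_order all_algebra.
From mathcomp Require Import boolp classical_sets cardinality.
From mathcomp Require Import mpoly.
From mathcomp Require Import zify ring.

(**
Write A for the polynomial ring in the variables x_{r+1}, ..., x_n.  The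
hypotheses describe J on the level of monomials: a monomial m of J either has
its truncation Phi_r(m) in J already, or satisfies Phi_r(m) = u, because every
proper multiple of u inside S(r) lies in Pi_r(J).  So the generators of J outside
S(r) are of the form u * w with w a monomial of A, and everything comes down to
showing that, for u <> 1, one such w divides all the others.  Borel type moves
any w to a power of x_{r+1}, so some u * x_{r+1}^e is in J; take e minimal.

Let f in P have initial monomial u * w.  Cancelling the monomials of f whose
truncation lies in J, which is possible with elements of P since grevlex is a
well-order (tail_reduction), one may write f = u * a + f0 where a is in A with
initial monomial w, and no monomial of f0 has its truncation in J or equal to u.
Do this for g with initial monomial u * x_{r+1}^e and for h with initial monomial
u * w, with coefficients a_g and a_h.  In a_h * g - a_g * h the multiples of u
cancel, hence no monomial of this element of P can be the initial one: the
difference is 0.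

Primality of P enters now.  The polynomial ring is factorial, so a_g = d * a' and
a_h = d * b' with a' and b' coprime; from b' * g = a' * h follows g = q * a'.  The
initial monomial of a' is a power of x_{r+1}, which is not in J as u <> 1, so a' is
not in P and q is.  The initial monomial of q is u * in(d), and in(d) divides
x_{r+1}^e, so in(d) = x_{r+1}^e by minimality of e.  Finally in(d) divides
in(a_h) = w (tail_multiple_of_minimal_power).  In other words, S/P is torsion
free over A, so the coefficients a fill a divisorial ideal of A, and those are
principal.

Factoriality of the multivariate polynomial ring (factorial_mpoly) is Gauss's
theorem, iterated over the isomorphism of k[x_1..x_{n+1}] with k[x_1..x_n][X].
*)

Set Implicit Arguments.
Unset Strict Implicit.
Unset Printing Implicit Defensive.

Import GRing.Theory.
Local Open Scope ring_scope.
Local Open Scope classical_set_scope.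

(** * Unique factorisation in polynomial rings over a field *)

Definition divides (R : comNzRingType) (a b : R) : Prop := exists c, b = c * a.

Section Divides.
Variable R : comNzRingType.
Implicit Types p a b : R.

Lemma dividesD p a b : divides p a -> divides p b -> divides p (a + b).
Proof. by move=> [x ->] [y ->]; exists (x + y); rewrite mulrDl. Qed.

Lemma dividesB p a b : divides p a -> divides p b -> divides p (a - b).
Proof. by move=> [x ->] [y ->]; exists (x - y); rewrite mulrBl. Qed.

Lemma dividesMl p a b : divides p b -> divides p (a * b).
Proof. by move=> [x ->]; exists (a * x); rewrite mulrA. Qed.

Lemma dividesMr p a b : divides p a -> divides p (a * b).
Proof. by rewrite mulrC; apply: dividesMl. Qed.

Lemma divides_sum (I : Type) (s : seq I) (Q : pred I) (F : I -> R) p :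
  (forall i, Q i -> divides p (F i)) -> divides p (\sum_(i <- s | Q i) F i).
Proof.
move=> h; elim/big_ind: _ => //; last exact: dividesD.
by exists 0; rewrite mul0r.
Qed.

Lemma divides_polyC p (f : {poly R}) :
  (forall i, divides p f`_i) -> divides p%:P f.
Proof.
move=> /choice [F EF]; exists (\poly_(i < size f) F i).
apply/polyP => i; rewrite coefMC coef_poly; case: ltnP => h; first exact: EF.
by rewrite mul0r nth_default.
Qed.

End Divides.

Definition prime_elem (R : comUnitRingType) (p : R) : Prop :=
  [/\ p != 0, p \isn't a GRing.unit &
      forall a b, divides p (a * b) -> divides p a \/ divides p b].

(** A domain is factorial as soon as it has a multiplicative notion of size and
every non-unit has a prime divisor: dividing out that prime lowers the size, so
factorisations terminate, and a factorisation into primes is unique. *)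
Record factorial_norm (R : idomainType) (N : R -> nat) : Prop := FactorialNorm {
  normM : forall a b, a != 0 -> b != 0 -> N (a * b) = (N a + N b)%N;
  norm_unit : forall a, a != 0 -> N a = 0%N -> a \is a GRing.unit;
  prime_divisor : forall a, a != 0 -> (0 < N a)%N ->
    exists2 p, prime_elem p & divides p a }.

Section FactorialNorm.
Variables (R : idomainType) (N : R -> nat).
Hypothesis fN : factorial_norm N.

Lemma norm_gt0 a : a != 0 -> a \isn't a GRing.unit -> (0 < N a)%N.
Proof. by move=> a0; rewrite lt0n; apply: contra => /eqP /(norm_unit fN a0). Qed.

(** Euclid's lemma for a composite a: split off a prime p of a.  It does not divide
b, hence divides c, and cancelling p on both sides leaves a smaller a. *)
Lemma coprime_divides (a b c : R) :
    a != 0 -> (forall p, prime_elem p -> divides p a -> ~ divides p b) ->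
  divides a (b * c) -> divides a c.
Proof.
move: {2}(N a) (leqnn (N a)) => s.
elim: s a c => [|s IH] a c leNs a0 cop ab.
  have ua : a \is a GRing.unit by apply: (norm_unit fN) => //; apply/eqP; rewrite -leqn0.
  by exists (c / a); rewrite divrK.
have [ua|nua] := boolP (a \is a GRing.unit); first by exists (c / a); rewrite divrK.
have [p pp pa] := prime_divisor fN a0 (norm_gt0 a0 nua).
have [a' Ea] := pa; have [p0 pnu pprime] := pp.
have pbc : divides p (b * c).
  by case: ab => q ->; exists (q * a'); rewrite Ea mulrA.
have [/(cop _ pp pa)//|[c' Ec]] := pprime _ _ pbc.
have a'0 : a' != 0 by apply: contraNneq a0 => Z; rewrite Ea Z mul0r.
have [] := IH a' c' _ a'0.
- rewrite Ea (normM fN) // in leNs.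
  by rewrite -ltnS; apply: leq_trans leNs; rewrite -addn1 leq_add2l norm_gt0.
- move=> q qp [x Ex]; apply: (cop q qp); exists (p * x).
  by rewrite Ea Ex mulrC mulrA.
- case: ab => q Eq; exists q; apply: (mulIf p0).
  by rewrite -mulrA -Ec Eq Ea mulrA.
by move=> x Ex; exists x; rewrite Ec Ex Ea mulrA.
Qed.

(** d is the greatest common divisor of a and b, and the last clause is the form in
which coprimality of the cofactors a' and b' gets used.  Stripping common primes
from a and b ends because the norm of a drops. *)
Lemma gcd_cofactors (a b : R) : a != 0 ->
  exists d a' b', [/\ a = d * a', b = d * b' &
    forall c, divides a' (b' * c) -> divides a' c].
Proof.
move: {2}(N a) (leqnn (N a)) => s.
elim: s a b => [|s IH] a b leNs a0; last first.
  have [[p [pp [a1 Ea] [b1 Eb]]]|npq] :=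
    pselect (exists p, [/\ prime_elem p, divides p a & divides p b]).
    have [p0 pnu _] := pp.
    have a10 : a1 != 0 by apply: contraNneq a0 => Z; rewrite Ea Z mul0r.
    have [|d [a' [b' [Ea' Eb' cop]]]] := IH a1 b1 _ a10.
      rewrite Ea (normM fN) // in leNs.
      by rewrite -ltnS; apply: leq_trans leNs; rewrite -addn1 leq_add2l norm_gt0.
    exists (p * d), a', b'; split => //.
      by rewrite Ea Ea' mulrC mulrA.
    by rewrite Eb Eb' mulrC mulrA.
  exists 1, a, b; rewrite !mul1r; split => // c; apply: coprime_divides => //.
  by move=> p pp pa pb; apply: npq; exists p.
exists 1, a, b; rewrite !mul1r; split => // c _; exists (c / a); rewrite divrK //.
by apply: (norm_unit fN) => //; apply/eqP; rewrite -leqn0.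
Qed.

(** In a product f * g of polynomials not divisible by p, let i and j be the first
indices whose coefficients are not divisible by p: in the coefficient of degree
i + j, all terms but one are divisible by p. *)
Lemma prime_polyC (p : R) : prime_elem p -> prime_elem p%:P.
Proof.
move=> [p0 pnu pp]; split; first by rewrite polyC_eq0.
  by rewrite poly_unitE coefC eqxx size_polyC p0.
move=> f g pfg; apply: contrapT => /not_orP [nf ng].
have first_bad (h : {poly R}) : ~ divides p%:P h ->
    exists2 i, ~ divides p h`_i & forall j, (j < i)%N -> divides p h`_j.
  move=> nh; have [i0 hi0] : exists i, ~ divides p h`_i.
    by apply: contrapT => /forallNP hh; apply: nh; apply: divides_polyC => i;
       apply: contrapT; apply: hh.
  have ex : exists i, ~~ `[< divides p h`_i >] by exists i0; apply/asboolPn.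
  case: (ex_minnP ex) => i /asboolPn hi mini; exists i => // j ji.
  by apply: contrapT => /asboolPn /mini; rewrite leqNgt ji.
have [i nfi fi] := first_bad f nf; have [j ngj gj] := first_bad g ng.
have : divides p (f * g)`_(i + j).
  by have [q ->] := pfg; rewrite coefMC; exists q`_(i + j).
rewrite coefM.
have ltij : (i < (i + j).+1)%N by rewrite ltnS leq_addr.
rewrite (bigD1 (Ordinal ltij)) //= addKn => dsum.
suff : divides p (f`_i * g`_j) by move/pp => [].
rewrite -[X in divides _ X](addrK
  (\sum_(l < (i + j).+1 | l != Ordinal ltij) f`_l * g`_(i + j - l))).
apply: dividesB => //; apply: divides_sum => l.
rewrite -val_eqE /= neq_ltn => /orP [li|il].
  by apply: dividesMr; apply: fi.
apply: dividesMl; apply: gj.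
by rewrite ltn_subLR ?ltn_add2r // -ltnS.
Qed.

(** The substitute for passing to primitive polynomials: the primes of the constant c
stay prime in R[X], so each of them divides q or d and can be cancelled there. *)
Lemma split_constant (c : R) (f q d : {poly R}) : c != 0 -> c%:P * f = q * d ->
  exists c1 c2 q1 d1, [/\ c1 != 0, d = c1%:P * d1, q = c2%:P * q1 & f = q1 * d1].
Proof.
move: {2}(N c) (leqnn (N c)) => s.
elim: s c q d => [|s IH] c q d leNs c0 E; have [uc|nuc] := boolP (c \is a GRing.unit).
- exists 1, c, ((c^-1)%:P * q), d; rewrite oner_neq0 mul1r mulrA -polyCM divrr // mul1r.
  by split=> //; rewrite -mulrA -E mulrA -polyCM mulVr // mul1r.
- by have := leq_trans (norm_gt0 c0 nuc) leNs; rewrite ltnn.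
- exists 1, c, ((c^-1)%:P * q), d; rewrite oner_neq0 mul1r mulrA -polyCM divrr // mul1r.
  by split=> //; rewrite -mulrA -E mulrA -polyCM mulVr // mul1r.
have [p pp [c' Ec]] := prime_divisor fN c0 (norm_gt0 c0 nuc).
have [p0 pnu _] := pp; have pP0 : p%:P != 0 by rewrite polyC_eq0.
have c'0 : c' != 0 by apply: contraNneq c0 => Z; rewrite Ec Z mul0r.
have leN' : (N c' <= s)%N.
  rewrite Ec (normM fN) // in leNs.
  by rewrite -ltnS; apply: leq_trans leNs; rewrite -addn1 leq_add2l norm_gt0.
have [_ _ pprime] := prime_polyC pp.
have [|[q' Eq]|[d' Ed]] := pprime q d.
- by exists (c'%:P * f); rewrite -E Ec polyCM mulrAC.
- have [|c1 [c2 [q1 [d1 [c10 Ed1 Eq1 Ef]]]]] := IH c' q' d leN' c'0.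
    by apply: (mulIf pP0); rewrite [RHS]mulrAC -Eq -E Ec polyCM mulrAC.
  exists c1, (c2 * p), q1, d1; split=> //.
  by rewrite Eq Eq1 polyCM mulrAC.
have [|c1 [c2 [q1 [d1 [c10 Ed1 Eq1 Ef]]]]] := IH c' q d' leN' c'0.
  by apply: (mulIf pP0); rewrite -[RHS]mulrA -Ed -E Ec polyCM mulrAC.
exists (c1 * p), c2, q1, d1; split=> //; first by rewrite mulf_neq0.
by rewrite Ed Ed1 polyCM mulrAC.
Qed.

(** The degree alone does not see the constant factors; the norm of the leading
coefficient does, and both are additive on products. *)
Definition poly_norm (f : {poly R}) : nat := ((size f).-1 + N (lead_coef f))%N.

Lemma poly_normM f g : f != 0 -> g != 0 ->
  poly_norm (f * g) = (poly_norm f + poly_norm g)%N.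
Proof.
move=> f0 g0; rewrite /poly_norm lead_coefM (normM fN) ?lead_coef_eq0 // size_mul //.
rewrite addnACA; congr (_ + _)%N.
move: f0 g0; rewrite -!size_poly_gt0.
by case: (size f) => // x; case: (size g) => // y _ _; rewrite addSn addnS.
Qed.

Lemma poly_norm_eq0 f : f != 0 -> poly_norm f = 0%N -> f \is a GRing.unit.
Proof.
move=> f0 /eqP; rewrite addn_eq0 => /andP [/eqP s0 /eqP N0].
have sf : size f = 1%N by move: s0 f0; rewrite -size_poly_gt0; case: (size f) => // -[].
rewrite poly_unitE sf eqxx /= (norm_unit fN) //.
  by have := f0; rewrite -lead_coef_eq0 lead_coefE sf.
by move: N0; rewrite lead_coefE sf.
Qed.

(** Gauss's lemma, by pseudo-division instead of the fraction field.  Up to constants,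
f = q1 * d1 and g is a multiple of d1, where d1 comes from the gcd d of f and g.
If q1 is a unit then f divides a constant multiple of g, if d1 is a unit then a
Bezout relation shows that f divides a constant multiple of h; in both cases
split_constant removes the constant, since f itself has no constant factor. *)
Lemma irreducible_poly_prime (f : {poly R}) : f != 0 -> (1 < size f)%N ->
    (forall g h, f = g * h -> g \is a GRing.unit \/ h \is a GRing.unit) ->
  prime_elem f.
Proof.
move=> f0 sf irr; split => //.
  by rewrite poly_unitE gtn_eqF.
(* Being irreducible of positive degree, f has no constant factor. *)
have cancel_const (c : R) (x y : {poly R}) : c != 0 -> c%:P * x = y * f -> divides f x.
  move=> c0 /(split_constant c0) [a1 [a2 [q2 [d2 [a10 Ed2 _ ->]]]]].
  have [ua|ud2] := irr _ _ Ed2.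
    exists (q2 * (a1%:P)^-1); rewrite Ed2 -!mulrA; congr (_ * _).
    by rewrite mulrA mulVr // mul1r.
  have := sf; rewrite Ed2 mul_polyC size_scale //.
  by move: ud2; rewrite poly_unitE => /andP [/eqP -> _].
move=> g h fgh.
pose d := Pdiv.Idomain.gcdp f g.
have /Pdiv.Idomain.dvdpP [[c q] /= c0] := Pdiv.Idomain.dvdp_gcdl f g.
rewrite -mul_polyC -/d => E1.
have /Pdiv.Idomain.dvdpP [[c' q'] /= c'0] := Pdiv.Idomain.dvdp_gcdr f g.
rewrite -mul_polyC -/d => E2.
have [c1 [c2 [q1 [d1 [c10 Ed Eq Ef]]]]] := split_constant c0 E1.
have [uq|ud] := irr _ _ Ef.
  left; apply: (cancel_const c' _ (q' * c1%:P * q1^-1)) => //.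
  by rewrite E2 Ed Ef -!mulrA (mulrA q1^-1) mulVr // mul1r.
right.
have [[s t] /= Est] := Pdiv.Idomain.Bezoutp f g.
have /Pdiv.Idomain.eqpP [[x y] /= /andP[x0 y0] E] := Est.
rewrite -/d -!mul_polyC in E.
have [z Ez] := fgh.
apply: (cancel_const (y * c1) _ (x%:P * d1^-1 * (s * h + t * z))).
  by rewrite mulf_neq0.
have : (y * c1)%:P * d1 * h = x%:P * (s * h + t * z) * f.
  rewrite polyCM -(mulrA y%:P) -Ed -E -!mulrA; congr (_ * _).
  rewrite !mulrDl -!mulrA Ez; congr (_ + _ ); congr (_ * _).
  by rewrite mulrC.
move=> /(congr1 ( *%R d1^-1)).
rewrite !mulrA [d1^-1 * _]mulrC -(mulrA _ d1^-1) mulVr // mulr1 => ->.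
by rewrite (mulrC d1^-1).
Qed.

(** A divisor of minimal positive norm is irreducible, hence prime, unless it is a
constant, in which case a prime of R divides it. *)
Theorem factorial_poly : factorial_norm poly_norm.
Proof.
split; [exact: poly_normM | exact: poly_norm_eq0 | ] => f.
move: {2}(poly_norm f) (leqnn (poly_norm f)) => s.
elim: s f => [|s IH] f leNs f0 Nf; first by move: leNs; rewrite leqNgt Nf.
have [sf|sf] := leqP (size f) 1.
  have Ef := size1_polyC sf.
  have c0 : f`_0 != 0 by rewrite Ef polyC_eq0 in f0.
  have [|p pp [q Eq]] := prime_divisor fN c0.
    by move: Nf; rewrite /poly_norm {1 2}Ef lead_coefC size_polyC c0.
  exists p%:P; first exact: prime_polyC.
  by exists q%:P; rewrite Ef Eq polyCM.
have [irr|] := pselect (forall g h, f = g * h -> g \is a GRing.unit \/ h \is a GRing.unit).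
  exists f; first exact: irreducible_poly_prime.
  by exists 1; rewrite mul1r.
move=> /existsNP [g] /existsNP [h] /not_implyP [Ef] /not_orP [/negP ng /negP nh].
have g0 : g != 0 by apply: contraNneq f0 => Z; rewrite Ef Z mul0r.
have h0 : h != 0 by apply: contraNneq f0 => Z; rewrite Ef Z mulr0.
have Ng : (0 < poly_norm g)%N by rewrite lt0n; apply: contra ng => /eqP/(poly_norm_eq0 g0).
have Nh : (0 < poly_norm h)%N by rewrite lt0n; apply: contra nh => /eqP/(poly_norm_eq0 h0).
have [||//|p pp pg] := IH g.
- rewrite Ef poly_normM // in leNs.
  by rewrite -ltnS; apply: leq_trans leNs; rewrite -addn1 leq_add2l.
- by [].
by exists p => //; rewrite Ef; apply: dividesMr.
Qed.

End FactorialNorm.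

Lemma factorial_iso (R T : idomainType) (phi : {rmorphism R -> T}) (psi : T -> R)
    (N : T -> nat) :
  cancel phi psi -> cancel psi phi -> factorial_norm N -> factorial_norm (N \o phi).
Proof.
move=> phiK psiK fN.
have inj0 a : (phi a == 0) = (a == 0) by rewrite -(rmorph0 phi) (can_eq phiK).
have unitE a : (phi a \is a GRing.unit) -> a \is a GRing.unit.
  move=> ua; apply/unitrP; exists (psi (phi a)^-1).
  by split; apply: (can_inj phiK); rewrite rmorphM psiK rmorph1 ?mulVr ?divrr.
have divE a b : divides (phi a) (phi b) -> divides a b.
  by move=> [c E]; exists (psi c); apply: (can_inj phiK); rewrite rmorphM psiK.
split=> /=.
- by move=> a b a0 b0; rewrite rmorphM (normM fN) ?inj0.
- by move=> a a0 Na; apply: unitE; apply: (norm_unit fN); rewrite ?inj0.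
move=> a a0 Na; have [|p [p0 pu pp] pa] := prime_divisor fN _ Na; first by rewrite inj0.
exists (psi p); last by apply: divE; rewrite psiK.
split; first by rewrite -inj0 psiK.
  by apply: contra pu => /(rmorph_unit phi); rewrite psiK.
move=> x y [z E]; have [|h|h] := pp (phi x) (phi y).
- by exists (phi z); rewrite -rmorphM E rmorphM psiK.
- by left; apply: divE; rewrite psiK.
- by right; apply: divE; rewrite psiK.
Qed.

Section MultivariateFactorial.
Variable k : fieldType.

(** The inverse of muni, as an evaluation so that it is visibly a ring morphism. *)
Definition unmuni n (q : {poly {mpoly k[n]}}) : {mpoly k[n.+1]} :=
  (map_poly (@mwiden n k) q).['X_ord_max].

Lemma unmuniD n : {morph @unmuni n : p q / p + q}.
Proof. by move=> p q; rewrite /unmuni rmorphD hornerD. Qed.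

Lemma unmuniM n : {morph @unmuni n : p q / p * q}.
Proof. by move=> p q; rewrite /unmuni rmorphM hornerM. Qed.

Lemma unmuniC n c : @unmuni n c%:P = mwiden c.
Proof. by rewrite /unmuni map_polyC hornerC. Qed.

Lemma unmuniX n i : @unmuni n 'X^i = 'X_ord_max ^+ i.
Proof. by rewrite /unmuni map_polyXn hornerXn. Qed.

Lemma muniX n (m : 'X_{1..n.+1}) : muni ('X_[m] : {mpoly k[n.+1]}) =
  ('X_[[multinom m (widen_ord (leqnSn n) i) | i < n]])%:P * 'X^(m ord_max).
Proof. by rewrite muniE msuppX big_seq1 mcoeffX eqxx scale1r mul_polyC. Qed.

Lemma mnmwiden_add_max n (m : 'X_{1..n.+1}) :
  (mnmwiden [multinom m (widen_ord (leqnSn n) i) | i < n] + U_(ord_max) *+ m ord_max)%MM = m.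
Proof.
apply/mnmP => j; rewrite mnmDE mulmnE mnm1E.
have [->|jm] := eqVneq j ord_max; first by rewrite mnmwiden_ordmax mul1n.
have jn : (j < n)%N.
  by rewrite ltn_neqAle -ltnS ltn_ord andbT; apply: contra jm => /eqP h; apply/eqP/val_inj.
have -> : j = widen_ord (leqnSn n) (Ordinal jn) by apply/val_inj.
by rewrite mnmwiden_widen mnmE mul0n addn0.
Qed.

Lemma muniK n : cancel (@muni n k) (@unmuni n).
Proof.
elim/mpolyind => [|c m p _ _ IH]; first by rewrite muni0 /unmuni rmorph0 horner0.
rewrite muniD unmuniD IH -mul_mpolyC muniM muniC muniX !unmuniM !unmuniC unmuniX.
rewrite mwidenC mwidenX mpolyXn -mpolyXD mnmwiden_add_max //.
Qed.

Lemma unmuniK n : cancel (@unmuni n) (@muni n k).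
Proof.
have muniW (p : {mpoly k[n]}) : muni (mwiden p) = p%:P.
  elim/mpolyind: p => [|c m p _ _ IH]; first by rewrite mwiden0 muni0.
  rewrite mwidenD muniD IH mwidenZ -mul_mpolyC muniM muniC mwidenX muniX.
  rewrite mnmwiden_ordmax expr0 mulr1 -polyCM -polyCD mul_mpolyC.
  set m' := [multinom _ | i < n]; have -> // : m' = m.
  by apply/mnmP => i; rewrite mnmE mnmwiden_widen.
have muniXm : muni 'X_ord_max = 'X :> {poly {mpoly k[n]}}.
  rewrite muniX mnm1E eqxx expr1; set m' := [multinom _ | i < n].
  have -> : m' = 0%MM; last by rewrite mpolyX0 mul1r.
  by apply/mnmP => i; rewrite mnmE mnm1E mnm0E -val_eqE /= gtn_eqF.
elim/poly_ind => [|q c IH]; first by rewrite /unmuni rmorph0 horner0 muni0.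
by rewrite unmuniD unmuniM unmuniC -(expr1 'X) unmuniX !expr1 muniD muniM IH muniW muniXm.
Qed.

Theorem factorial_mpoly n : exists N : {mpoly k[n]} -> nat, factorial_norm N.
Proof.
elim: n => [|n [N fN]].
  exists (fun _ => 0%N); split=> // a a0 _.
  rewrite -(mpolyKC a) rmorph_unit // unitfE.
  by apply: contraNneq a0 => h; rewrite -(mpolyKC a) h mpolyC0.
exists (poly_norm N \o @muni n k).
exact: factorial_iso (@muniK n) (@unmuniK n) (factorial_poly fN).
Qed.

End MultivariateFactorial.

(** * The graded reverse lexicographic order and initial monomials *)

Section Grevlex.
Variable n : nat.
Implicit Types m : 'X_{1..n}.

Lemma grevlexP m1 m2 : reflect
  ((mdeg m1 < mdeg m2)%N \/ mdeg m1 = mdeg m2 /\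
     exists i : 'I_n, (m2 i < m1 i)%N /\ forall j : 'I_n, (i < j)%N -> m1 j = m2 j)
  (grevlex_lt m1 m2).
Proof.
apply: (iffP orP) => [[->|/andP[/eqP d /existsP[i /andP[ii /forallP h]]]]|].
- by left.
- right; split=> //; exists i; split=> // j ij.
  by have := h j; rewrite ij => /eqP.
- move=> [->|[d [i [ii h]]]]; first by left.
  right; rewrite d eqxx; apply/existsP; exists i; rewrite ii /=.
  by apply/forallP => j; apply/implyP => /h ->.
Qed.

Lemma grevlex_irr m : grevlex_lt m m = false.
Proof. by apply/grevlexP => -[|[_ [i [] ]]]; rewrite ltnn. Qed.

Lemma grevlex_trans m2 m1 m3 : grevlex_lt m1 m2 -> grevlex_lt m2 m3 -> grevlex_lt m1 m3.
Proof.
move=> /grevlexP h12 /grevlexP h23; apply/grevlexP.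
case: h12 => [d12|[d12 [i [i12 h12]]]].
  by case: h23 => [d23|[d23 _]]; left; lia.
case: h23 => [d23|[d23 [j [j23 h23]]]]; first by left; lia.
right; split; first by lia.
case: (ltngtP i j) => ij.
- exists j; split; first by rewrite h12.
  by move=> l jl; rewrite h12 ?h23 //; apply: ltn_trans jl.
- exists i; split; first by rewrite -h23.
  by move=> l jl; rewrite h12 ?h23 //; apply: ltn_trans jl.
- have Eij : i = j by apply/val_inj.
  exists j; split; first by rewrite Eij in i12; lia.
  by move=> l jl; rewrite h12 ?h23 // Eij.
Qed.

Lemma grevlex_total m1 m2 : [\/ grevlex_lt m1 m2, m1 = m2 | grevlex_lt m2 m1].
Proof.
have [->|m12] := eqVneq m1 m2; first by constructor 2.
case: (ltngtP (mdeg m1) (mdeg m2)) => d.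
- by constructor 1; apply/grevlexP; left.
- by constructor 3; apply/grevlexP; left.
have [i0 hi0] : exists i, m1 i != m2 i.
  apply/existsP; apply: contra_neqT m12 => /existsPn h; apply/mnmP => i.
  by apply/eqP; rewrite -[_ == _]negbK h.
case: (@arg_maxnP _ i0 (fun i => m1 i != m2 i) val hi0) => i ne maxi.
have eqj (j : 'I_n) : (i < j)%N -> m1 j = m2 j.
  by move=> ij; apply: contraTeq ij => /maxi; rewrite -leqNgt.
move: ne; rewrite neq_ltn => /orP [lt|lt].
  by constructor 3; apply/grevlexP; right; split=> //; exists i; split=> // j /eqj ->.
by constructor 1; apply/grevlexP; right; split=> //; exists i; split.
Qed.

Lemma grevlex_add2r m m1 m2 :
  grevlex_lt m1 m2 -> grevlex_lt (m1 + m)%MM (m2 + m)%MM.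
Proof.
move=> /grevlexP [d|[d [i [ii h]]]]; apply/grevlexP; rewrite !mdegD.
  by left; rewrite ltn_add2r.
right; rewrite d; split=> //; exists i; split=> [|j ij]; rewrite !mnmDE ?ltn_add2r //.
by rewrite h.
Qed.

Lemma grevlex_add2l m m1 m2 :
  grevlex_lt m1 m2 -> grevlex_lt (m + m1)%MM (m + m2)%MM.
Proof. by rewrite ![(m + _)%MM]addmC; apply: grevlex_add2r. Qed.

Lemma grevlex_cancel2l m m1 m2 :
  grevlex_lt (m + m1)%MM (m + m2)%MM -> grevlex_lt m1 m2.
Proof.
move=> h; case: (grevlex_total m1 m2) => // [E|/(grevlex_add2l m) h'].
  by move: h; rewrite E grevlex_irr.
by have := grevlex_trans h h'; rewrite grevlex_irr.
Qed.

(** The degree comes first in the order, so only finitely many monomials are below m,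
and their number serves as the induction measure. *)
Lemma grevlex_wf_ind (Q : 'X_{1..n} -> Prop) :
  (forall m, (forall m', grevlex_lt m' m -> Q m') -> Q m) -> forall m, Q m.
Proof.
move=> step m.
pose below m := [set m' : 'X_{1..n < (mdeg m).+1} | grevlex_lt m' m]%SET.
have below_lt m1 m2 : grevlex_lt m1 m2 -> (#|below m1| < #|below m2|)%N.
  move=> lt12.
  have ledeg m3 m4 : grevlex_lt m3 m4 -> (mdeg m3 <= mdeg m4)%N.
    by move=> /grevlexP [/ltnW //|[-> _]].
  have lt' (x : 'X_{1..n < (mdeg m1).+1}) : (mdeg x < (mdeg m2).+1)%N.
    by apply: leq_trans (bmdeg x) _; rewrite ltnS ledeg.
  pose w x := BMultinom (lt' x).
  have w_inj : injective w.
    by move=> x y /(congr1 (@bmnm _ _)) /= E; apply: val_inj.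
  rewrite -(card_imset _ w_inj); apply: proper_card; apply/properP; split.
    apply/fintype.subsetP => y /imsetP [x]; rewrite !inE => xm ->.
    exact: grevlex_trans xm lt12.
  have b1 : (mdeg m1 < (mdeg m2).+1)%N by rewrite ltnS ledeg.
  exists (BMultinom b1); first by rewrite inE.
  apply/negP => /imsetP [x]; rewrite inE => xm E.
  have E' : m1 = x by exact: (congr1 (@bmnm _ _) E).
  by rewrite -E' grevlex_irr in xm.
move: {2}#|below m| (leqnn #|below m|) => s.
elim: s m => [|s IH] m le; apply: step => m' /below_lt lt.
  by have := leq_trans lt le.
by apply: IH; rewrite -ltnS; apply: leq_trans lt le.
Qed.

End Grevlex.

Section InitialMonomials.
Variables (k : fieldType) (n : nat).
Local Notation S := {mpoly k[n]}.
Implicit Types (f g h : S) (m : 'X_{1..n}).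

Lemma initialP f m : is_initial_monomial f m <->
  f@_m != 0 /\ forall m', f@_m' != 0 -> m' != m -> grevlex_lt m' m.
Proof.
rewrite /is_initial_monomial mcoeff_msupp; split=> -[h1 h2]; split=> //.
  by move=> m'; rewrite -mcoeff_msupp; apply: h2.
by move=> m'; rewrite mcoeff_msupp; apply: h2.
Qed.

Lemma seq_grevlex_max (s : seq 'X_{1..n}) : s != [::] ->
  exists2 m, m \in s & forall m', m' \in s -> m' != m -> grevlex_lt m' m.
Proof.
elim: s => // x s IH _; have [->|/IH [m ms mx]] := eqVneq s [::].
  by exists x; rewrite ?mem_seq1 // => m'; rewrite mem_seq1 => ->.
case: (grevlex_total x m) => [xm|->|mx'].
- exists m; rewrite ?inE ?ms ?orbT // => m'; rewrite inE => /orP[/eqP ->//|].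
  exact: mx.
- exists m; rewrite ?inE ?ms ?orbT // => m'; rewrite inE => /orP[/eqP -> /eqP//|].
  exact: mx.
- exists x; rewrite ?inE ?eqxx // => m'; rewrite inE => /orP[-> //|m's _].
  have [->//|ne] := eqVneq m' m.
  exact: grevlex_trans (mx _ m's ne) mx'.
Qed.

Lemma initial_exists f : f != 0 -> exists m, is_initial_monomial f m.
Proof.
by rewrite -msupp_eq0 => /seq_grevlex_max [m ms h]; exists m; split.
Qed.

Lemma initial_unique f m1 m2 :
  is_initial_monomial f m1 -> is_initial_monomial f m2 -> m1 = m2.
Proof.
move=> [s1 h1] [s2 h2]; apply/eqP; apply: contraT => ne.
have l12 := h2 _ s1 ne; rewrite eq_sym in ne; have l21 := h1 _ s2 ne.
by have := grevlex_trans l12 l21; rewrite grevlex_irr.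
Qed.

Lemma initial_neq0 f m : is_initial_monomial f m -> f != 0.
Proof. by move=> [ms _]; apply: contraTneq ms => ->; rewrite msupp0. Qed.

Lemma mcoeffM_neq0 f g m : (f * g)@_m != 0 ->
  exists m1 m2, [/\ m = (m1 + m2)%MM, f@_m1 != 0 & g@_m2 != 0].
Proof.
rewrite -mcoeff_msupp => /msuppM_le /allpairsP [[m1 m2] /= [h1 h2 E]].
by exists m1, m2; rewrite -!mcoeff_msupp.
Qed.

(** Every product of monomials of f and g other than m1 and m2 is strictly smaller than
m1 + m2, so the coefficient there is the product of the leading coefficients. *)
Lemma initialM f g m1 m2 : is_initial_monomial f m1 -> is_initial_monomial g m2 ->
  is_initial_monomial (f * g) (m1 + m2)%MM.
Proof.
move=> /initialP [f1 h1] /initialP [g2 h2].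
have bound p q : f@_p != 0 -> g@_q != 0 -> (p, q) != (m1, m2) ->
    grevlex_lt (p + q)%MM (m1 + m2)%MM.
  move=> fp gq; have [->|p1] := eqVneq p m1.
    rewrite xpair_eqE eqxx /= => q2; apply: grevlex_add2l; exact: h2.
  move=> _; have lt := grevlex_add2r q (h1 _ fp p1).
  have [<-//|q2] := eqVneq q m2.
  exact: grevlex_trans lt (grevlex_add2l _ (h2 _ gq q2)).
apply/initialP; split; last first.
  move=> m' /mcoeffM_neq0 [p [q [-> fp gq]]] ne; apply: bound => //.
  by apply: contra_neq ne => -[-> ->].
rewrite {1}(_ : f = f@_m1 *: 'X_[m1] + (f - f@_m1 *: 'X_[m1])); last by rewrite addrC subrK.
rewrite mulrDl mcoeffD -scalerAl mcoeffZ (mulrC 'X_[m1]) mcoeffMX.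
set f' := f - _.
have -> : (f' * g)@_(m1 + m2) = 0.
  apply/eqP; apply: contraT => /mcoeffM_neq0 [p [q [E fp gq]]].
  have pm : p != m1.
    apply: contraNneq fp => ->.
    by rewrite mcoeffB mcoeffZ mcoeffX eqxx mulr1 subrr.
  have fp' : f@_p != 0.
    by move: fp; rewrite mcoeffB mcoeffZ mcoeffX [m1 == _]eq_sym (negbTE pm) mulr0 subr0.
  have : grevlex_lt (p + q)%MM (m1 + m2)%MM.
    by apply: bound => //; apply: contra_neq pm => -[].
  by rewrite -E grevlex_irr.
by rewrite addr0 mulf_neq0.
Qed.

Lemma initialX m : is_initial_monomial ('X_[m] : S) m.
Proof. by split; rewrite ?msuppX ?inE // => m'; rewrite inE => ->. Qed.

End InitialMonomials.

(** * Monomial ideals and truncation to the first variables *)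

Section MonomialIdeals.
Variables (k : fieldType) (n : nat).
Local Notation S := {mpoly k[n]}.
Implicit Types (f g h : S) (m : 'X_{1..n}) (I : set S).

(** Unlike idealr_closed, this admits the unit ideal. *)
Definition is_ideal (R : comNzRingType) (I : set R) : Prop :=
  [/\ I 0, forall f g : R, I f -> I g -> I (f + g) & forall f g : R, I g -> I (f * g)].

Lemma ideal_gen_is_ideal (R : comNzRingType) (A : set R) : is_ideal (ideal_gen A).
Proof.
split.
- by exists [::]; rewrite ?big_nil.
- move=> f g [s hs ->] [t ht ->]; exists (s ++ t); last by rewrite big_cat.
  by move=> c; rewrite mem_cat => /orP [/hs|/ht].
- move=> f g [s hs ->]; exists [seq (f * c.1, c.2) | c <- s].
    by move=> c /mapP [c' /hs h ->].
  by rewrite big_map mulr_sumr; apply: eq_bigr => c _; rewrite mulrA.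
Qed.

Lemma ideal_gen_mem (R : comNzRingType) (A : set R) : A `<=` ideal_gen A.
Proof.
move=> a Aa; exists [:: (1, a)]; last by rewrite big_seq1 mul1r.
by move=> c; rewrite inE => /eqP ->.
Qed.

Lemma ideal_gen_le (R : comNzRingType) (A I : set R) :
  is_ideal I -> A `<=` I -> ideal_gen A `<=` I.
Proof.
move=> [I0 ID IM] AI f [s hs ->].
elim: s hs => [|c s IH] hs; first by rewrite big_nil.
rewrite big_cons; apply: ID.
  by apply/IM/AI/hs; rewrite inE eqxx.
by apply: IH => c' cs; apply: hs; rewrite inE cs orbT.
Qed.

Lemma ideal_of_monomials I f : is_ideal I ->
  (forall m, f@_m != 0 -> I 'X_[m]) -> I f.
Proof.
move=> [I0 ID IM] h; rewrite (mpolyE f) big_seq.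
apply: (big_ind I) => // m; rewrite mcoeff_msupp => /h Im.
by rewrite -mul_mpolyC; apply: IM.
Qed.

Lemma monomial_idealP (M : set 'X_{1..n}) f :
  ideal_gen [set ('X_[m] : S) | m in M] f <->
  forall m, f@_m != 0 -> exists2 m0, M m0 & (m0 <= m)%MM.
Proof.
split; last first.
  move=> h; apply: ideal_of_monomials; first exact: ideal_gen_is_ideal.
  move=> m /h [m0 M0 /submK <-]; rewrite mpolyXD.
  have [_ _ IM] := ideal_gen_is_ideal [set ('X_[m] : S) | m in M].
  by apply: IM; apply: ideal_gen_mem; exists m0.
move: f; apply: ideal_gen_le => [|_ [m Mm <-] m']; last first.
  by rewrite mcoeffX; have [<- _|] := eqVneq m m'; [exists m; rewrite ?lepm_refl|rewrite eqxx].
split=> [m|f g hf hg m|f g hg m].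
- by rewrite mcoeff0 eqxx.
- rewrite mcoeffD; have [->|/hf//] := eqVneq f@_m 0.
  by rewrite add0r => /hg.
- move=> /mcoeffM_neq0 [m1 [m2 [-> _ /hg [m0 M0 le]]]].
  exists m0 => //; apply: lepm_trans le _; exact: lem_addl.
Qed.

Lemma min_gens_below (J : set S) m : J 'X_[m] ->
  exists2 m0, min_gens J m0 & (m0 <= m)%MM.
Proof.
move: {2}(mdeg m) (leqnn (mdeg m)) => s.
elim: s m => [|s IH] m led Jm.
  exists m; rewrite ?lepm_refl //; split=> // m' _ /submK E.
  move: led; rewrite leqn0 mdeg_eq0 => /eqP m0; rewrite m0 in E *.
  by apply/eqP; move/eqP: E; rewrite mnmD_eq0 => /andP[].
have [mg|] := pselect (min_gens J m); first by exists m; rewrite ?lepm_refl.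
move=> /not_andP [//|/existsNP [m' /not_implyP [Jm' /not_implyP [le ne]]]].
have [|m0 g0 le0] := IH m' _ Jm'; last by exists m0; rewrite // (lepm_trans le0).
rewrite -ltnS; apply: leq_trans led; rewrite -[in X in (_ < X)%N](submK le) mdegD.
rewrite -[X in (X < _)%N]add0n ltn_add2r lt0n mdeg_eq0.
by apply/eqP => Z; apply: ne; rewrite -(submK le) Z add0m.
Qed.

End MonomialIdeals.

Section Truncation.
Variables (k : fieldType) (n r : nat).
Hypothesis r_lt_n : (r < n)%N.
Local Notation S := {mpoly k[n]}.
Implicit Types (f g h : S) (m : 'X_{1..n}) (I : set S).

Lemma Phi_mnmE m (i : 'I_n) : Phi_mnm r m i = if (i < r)%N then m i else 0%N.
Proof. exact: mnmE. Qed.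

Lemma Phi_mnmD m1 m2 : Phi_mnm r (m1 + m2)%MM = (Phi_mnm r m1 + Phi_mnm r m2)%MM.
Proof. by apply/mnmP => i; rewrite mnmDE !Phi_mnmE mnmDE; case: ifP. Qed.

Lemma Phi_mnm_le m : (Phi_mnm r m <= m)%MM.
Proof. by apply/mnm_lepP => i; rewrite Phi_mnmE; case: ifP. Qed.

Lemma Phi_mnm_mono m1 m2 : (m1 <= m2)%MM -> (Phi_mnm r m1 <= Phi_mnm r m2)%MM.
Proof.
by move=> /mnm_lepP h; apply/mnm_lepP => i; rewrite !Phi_mnmE; case: ifP.
Qed.

Definition mnm_restrict m : 'X_{1..r} := [multinom m (widen_ord (ltnW r_lt_n) i) | i < r].

Lemma mnm_embedE (w : 'X_{1..r}) (i : 'I_n) (ir : (i < r)%N) :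
  mnm_embed n w i = w (Ordinal ir).
Proof. by rewrite mnmE insubT. Qed.

Lemma mnm_embed0E (w : 'X_{1..r}) (i : 'I_n) : (r <= i)%N -> mnm_embed n w i = 0%N.
Proof. by move=> ri; rewrite mnmE insubF // ltnNge ri. Qed.

Lemma mnm_restrictK m : mnm_embed n (mnm_restrict m) = Phi_mnm r m.
Proof.
apply/mnmP => i; rewrite Phi_mnmE; case: ltnP => ir; last exact: mnm_embed0E.
by rewrite mnm_embedE mnmE; congr (m _); apply/val_inj.
Qed.

Lemma mnm_embedK (w : 'X_{1..r}) : mnm_restrict (mnm_embed n w) = w.
Proof.
apply/mnmP => i; rewrite mnmE (@mnm_embedE _ (widen_ord (ltnW r_lt_n) i) (ltn_ord i)).
by congr (w _); apply/val_inj.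
Qed.

Lemma Phi_mnm_embed (w : 'X_{1..r}) : Phi_mnm r (mnm_embed n w) = mnm_embed n w.
Proof. by rewrite -mnm_restrictK mnm_embedK. Qed.

Lemma mnm_embedD (w1 w2 : 'X_{1..r}) :
  mnm_embed n (w1 + w2)%MM = (mnm_embed n w1 + mnm_embed n w2)%MM.
Proof.
apply/mnmP => i; rewrite mnmDE; case: (ltnP i r) => ir.
  by rewrite !mnm_embedE mnmDE.
by rewrite !mnm_embed0E.
Qed.

Lemma trunc_varsX m : trunc_vars r ('X_[m] : S) =
  if Phi_mnm r m == m then 'X_[mnm_restrict m] else 0.
Proof.
rewrite /trunc_vars comp_mpolyX; case: eqP => [E|/eqP ne].
  rewrite (bigID (fun i : 'I_n => (i < r)%N)) /= [X in _ * X]big1 ?mulr1; last first.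
    by move=> i /negbTE ir; rewrite -E Phi_mnmE ir expr0.
  rewrite (big_ord_narrow (ltnW r_lt_n)) mpolyXE_id; apply: eq_bigr => i _.
  rewrite tnth_mktuple mnmE insubT //=; congr ('X_ _ ^+ _); exact/val_inj.
have [i ri mi] : exists2 i : 'I_n, (r <= i)%N & (0 < m i)%N.
  apply: contrapT => h; case/eqP: ne; apply/mnmP => i; rewrite Phi_mnmE.
  case: ltnP => // ri; apply/esym/eqP; rewrite -leqn0 leqNgt; apply/negP => mi.
  by apply: h; exists i.
rewrite (bigD1 i) //= tnth_mktuple insubF ?expr0n; last by rewrite ltnNge ri.
by rewrite eqn0Ngt mi mul0r.
Qed.

(** Truncation reads off the coefficients of the monomials in x_1, ..., x_r; this turns
membership of monomials in Pi_r(I) into membership in I. *)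
Lemma trunc_vars_coeff f w : (trunc_vars r f)@_w = f@_(mnm_embed n w).
Proof.
rewrite {2}(mpolyE f) /trunc_vars comp_mpolyEX !raddf_sum /=; apply: eq_bigr => m _.
rewrite !mcoeffZ; congr (_ * _); rewrite -/(trunc_vars r _) trunc_varsX mcoeffX.
case: eqP => [E|ne].
  rewrite mcoeffX; congr ((nat_of_bool _)%:R); apply/eqP/eqP => [<-|->]; last exact: mnm_embedK.
  by rewrite mnm_restrictK.
rewrite mcoeff0; case: eqP => // E; case: ne.
by rewrite E Phi_mnm_embed.
Qed.

Lemma trunc_vars_embed (w : 'X_{1..r}) : trunc_vars r ('X_[mnm_embed n w] : S) = 'X_[w].
Proof. by rewrite trunc_varsX Phi_mnm_embed eqxx mnm_embedK. Qed.

(** The ideals generated by monomials, described by their members. *)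
Definition monomial_ideal I : Prop :=
  is_ideal I /\ forall f m, I f -> f@_m != 0 -> I 'X_[m].

Lemma monomial_ideal_gen (M : set 'X_{1..n}) :
  monomial_ideal (ideal_gen [set ('X_[m] : S) | m in M]).
Proof.
split; first exact: ideal_gen_is_ideal.
move=> f m /monomial_idealP h /h h'; apply/monomial_idealP => m'.
by rewrite mcoeffX; have [<-|] := eqVneq m m'; rewrite ?eqxx.
Qed.

Lemma monomial_ideal_up I m1 m2 : is_ideal I -> (m1 <= m2)%MM ->
  I 'X_[m1] -> I 'X_[m2].
Proof. by move=> [_ _ IM] /submK <- h; rewrite mpolyXD; apply: IM. Qed.

Lemma Pi_supp I (g : {mpoly k[r]}) (w : 'X_{1..r}) : monomial_ideal I -> Pi r I g -> g@_w != 0 ->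
  I 'X_[mnm_embed n w].
Proof. by move=> [_ Im] [f If <-]; rewrite trunc_vars_coeff; apply: Im. Qed.

Lemma Pi_monomial I (w : 'X_{1..r}) : monomial_ideal I -> Pi r I 'X_[w] <-> I 'X_[mnm_embed n w].
Proof.
move=> Im; split=> [/(Pi_supp Im)|h]; first by apply; rewrite mcoeffX eqxx oner_neq0.
by exists 'X_[mnm_embed n w] => //; rewrite trunc_vars_embed.
Qed.

End Truncation.

(** * Elements of the prime ideal with prescribed initial monomial *)

Section InitialIdeals.
Variables (k : fieldType) (n : nat) (P : set {mpoly k[n]}).
Local Notation S := {mpoly k[n]}.
Implicit Types (f g h : S) (m : 'X_{1..n}).
Hypothesis P_ideal : is_ideal P.
Local Notation J := (initial_ideal P).

Lemma initial_ideal_monomial : monomial_ideal J.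
Proof. exact: monomial_ideal_gen. Qed.

Lemma mem_initial_ideal f m : P f -> is_initial_monomial f m -> J 'X_[m].
Proof.
move=> Pf fm; apply: ideal_gen_mem; exists m => //; exists f; split=> //.
exact: initial_neq0 fm.
Qed.

(** A monomial of J is a multiple of an initial monomial, and that multiple is again
initial, as the order is compatible with multiplication. *)
Lemma initial_ideal_lift m : J 'X_[m] -> exists2 f, P f & is_initial_monomial f m.
Proof.
move=> /monomial_idealP /(_ m); rewrite mcoeffX eqxx oner_neq0 => /(_ isT).
move=> [m0 [f [Pf _ fm]] le]; have [_ _ PM] := P_ideal.
exists ('X_[m - m0] * f); first exact: PM.
by rewrite -[X in is_initial_monomial _ X](submK le); apply: initialM fm; apply: initialX.
Qed.

(** Cancelling the largest unwanted monomial b' of f against an element of P with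
initial monomial b' only creates smaller ones, so grevlex induction on a strict
bound for the unwanted monomials applies.  The initial monomial m0, not being
unwanted, is larger than b' and survives. *)
Lemma tail_reduction (Q : 'X_{1..n} -> Prop) f m0 : (forall m, Q m -> J 'X_[m]) ->
    P f -> is_initial_monomial f m0 -> ~ Q m0 ->
  exists f', [/\ P f', is_initial_monomial f' m0 & forall m, f'@_m != 0 -> ~ Q m].
Proof.
move=> QJ Pf fm0 nQ0.
suff key : forall b f, P f -> is_initial_monomial f m0 ->
    (forall m, f@_m != 0 -> Q m -> grevlex_lt m b) ->
    exists f', [/\ P f', is_initial_monomial f' m0 & forall m, f'@_m != 0 -> ~ Q m].
  apply: (key m0 f) => // m fm Qm; have /initialP [_ h] := fm0; apply: h => //.
  by apply: contra_notN nQ0 => /eqP <-.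
elim/grevlex_wf_ind => b IH {Pf fm0 f} f Pf fm0 fb.
pose bad := [seq m <- msupp f | `[< Q m >]].
have [bad0|] := eqVneq bad [::].
  exists f; split=> // m; rewrite -mcoeff_msupp => fm Qm.
  have : m \in bad by rewrite mem_filter fm andbT; apply/asboolP.
  by rewrite bad0.
move=> /seq_grevlex_max [b']; rewrite mem_filter => /andP [/asboolP Qb' fb'] bmax.
rewrite mcoeff_msupp in fb'.
have [p Pp /initialP [pb' pmax]] := initial_ideal_lift (QJ _ Qb').
have /initialP [f0 fmax] := fm0.
have b'm0 : grevlex_lt b' m0.
  by apply: fmax => //; apply: contra_notN nQ0 => /eqP <-.
have [_ PD PM] := P_ideal.
pose c := f@_b' / p@_b'; pose f' := (- c%:MP) * p + f.
have f'E m : f'@_m = f@_m - c * p@_m.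
  by rewrite mcoeffD mulNr mcoeffN mcoeffCM addrC.
have f'b' : f'@_b' = 0 by rewrite f'E divfK ?subrr.
have f'supp m : f'@_m != 0 -> m != b' /\ (f@_m != 0 \/ grevlex_lt m b').
  move=> h; have mb : m != b' by apply: contraNneq h => ->; rewrite f'b'.
  split=> //; have [f0m|] := eqVneq f@_m 0; last by left.
  right; apply: pmax => //; apply: contraNneq h => p0.
  by rewrite f'E f0m p0 mulr0 subrr.
apply: (IH b' (fb _ fb' Qb') f').
- by apply: PD => //; apply: PM.
- apply/initialP; split.
    rewrite f'E; have [->|pm0] := eqVneq p@_m0 0; first by rewrite mulr0 subr0.
    have ne : m0 != b' by apply: contraPneq b'm0 => ->; rewrite grevlex_irr.
    by have := grevlex_trans (pmax _ pm0 ne) b'm0; rewrite grevlex_irr.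
  move=> m /f'supp [_ [fm|lt]] ne; first exact: fmax.
  exact: grevlex_trans lt b'm0.
move=> m /f'supp [ne [fm|//]] Qm; apply: bmax => //.
by rewrite mem_filter mcoeff_msupp fm andbT; apply/asboolP.
Qed.

End InitialIdeals.

Section Split.
Variables (k : fieldType) (n r : nat).
Local Notation S := {mpoly k[n]}.
Implicit Types (f g h : S) (m U : 'X_{1..n}).

Lemma sumX_supp (s : seq 'X_{1..n}) (Q : pred 'X_{1..n}) (F : 'X_{1..n} -> 'X_{1..n})
    (c : 'X_{1..n} -> k) m :
  (\sum_(x <- s | Q x) c x *: 'X_[F x])@_m != 0 ->
  exists x, [/\ x \in s, Q x & m = F x].
Proof.
rewrite raddf_sum /= big_seq_cond => h; apply: contrapT => nex; case/eqP: h.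
apply: big1 => x /andP [xs Qx]; rewrite mcoeffZ mcoeffX.
by case: eqP => [E|]; rewrite ?mulr0 //; case: nex; exists x.
Qed.

(** View f as a polynomial in x_1, ..., x_r with coefficients in the remaining
variables: a is the coefficient of U. *)
Lemma split_at_block U f : exists a f0, [/\ f = 'X_[U] * a + f0,
  forall m, a@_m != 0 -> Phi_mnm r (U + m) = U /\ f@_(U + m) != 0 &
  forall m, f0@_m != 0 -> Phi_mnm r m <> U /\ f@_m != 0].
Proof.
exists (\sum_(m <- msupp f | Phi_mnm r m == U) f@_m *: 'X_[m - U]).
exists (\sum_(m <- msupp f | Phi_mnm r m != U) f@_m *: 'X_[m]).
split.
- rewrite {1}(mpolyE f) (bigID (fun m => Phi_mnm r m == U)) /=; congr (_ + _).
  rewrite mulr_sumr; apply: eq_bigr => m /eqP E.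
  rewrite -scalerAr -mpolyXD addmC submK // -E; exact: Phi_mnm_le.
- move=> m /sumX_supp [x [xs /eqP E ->]].
  by rewrite addmC submK -?mcoeff_msupp // -{1}E; exact: Phi_mnm_le.
- by move=> m /sumX_supp [x [xs /eqP E ->]]; rewrite -mcoeff_msupp.
Qed.

Lemma initial_of_block U f a f0 w :
  f = 'X_[U] * a + f0 ->
  (forall m, a@_m != 0 -> Phi_mnm r (U + m) = U) ->
  (forall m, f0@_m != 0 -> Phi_mnm r m <> U) ->
  Phi_mnm r (U + w) = U -> is_initial_monomial f (U + w)%MM ->
  is_initial_monomial a w.
Proof.
move=> Ef ha h0 hw /initialP [fw fmax].
have aE m : Phi_mnm r (U + m) = U -> f@_(U + m) = a@_m.
  move=> hm; rewrite Ef mcoeffD mulrC mcoeffMX.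
  have [->|/h0//] := eqVneq f0@_(U + m) 0.
  by rewrite addr0.
apply/initialP; split; first by rewrite -aE.
move=> m am ne; apply: (@grevlex_cancel2l _ U); apply: fmax.
  by rewrite aE ?ha.
by rewrite eqm_add2l.
Qed.

End Split.

Section Core.
Variables (k : fieldType) (n r : nat) (P : set {mpoly k[n]}).
Hypothesis P_ideal : is_ideal P.
Hypothesis P_prime : forall f g, P (f * g) -> P f \/ P g.
Local Notation J := (initial_ideal P).
Local Notation S := {mpoly k[n]}.
Implicit Types (f g h : S) (m w : 'X_{1..n}).
Variable U : 'X_{1..n}.
Hypothesis PhiU : Phi_mnm r U = U.
Hypothesis JU : ~ J 'X_[U].
Hypothesis JPhi : forall m, J 'X_[m] -> J 'X_[Phi_mnm r m] \/ Phi_mnm r m = U.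
Hypothesis U0 : U <> 0%MM.

(** This is where primality of P is used.  An element of P none of whose monomials has its
truncation in J is determined by its coefficient at U, so two such elements g and h are
proportional over the ring of the remaining variables.  Dividing g by the cofactor a' of
the gcd of the two coefficients stays in P, so the minimality of e forces the initial
monomial of a' to be 1. *)
Lemma tail_multiple_of_minimal_power (l : 'I_n) e w : (r <= l)%N ->
  J 'X_[U + U_(l) *+ e] -> (forall c, J 'X_[U + U_(l) *+ c] -> (e <= c)%N) ->
  Phi_mnm r w = 0%MM -> J 'X_[U + w] -> (e <= w l)%N.
Proof.
move=> rl Je mine w0 Jw.
have Jm := initial_ideal_monomial P; have [Jid _] := Jm.
have Phil c : Phi_mnm r (U_(l) *+ c) = 0%MM.
  apply/mnmP => i; rewrite Phi_mnmE mnm0E; case: ltnP => // ir.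
  by rewrite mulmnE mnm1E -val_eqE /= gtn_eqF // (leq_trans ir rl).
pose Q m := J 'X_[Phi_mnm r m].
have QJ m : Q m -> J 'X_[m] by apply: monomial_ideal_up => //; apply: Phi_mnm_le.
have QU v : Phi_mnm r v = 0%MM -> ~ Q (U + v)%MM.
  by move=> v0; rewrite /Q Phi_mnmD PhiU v0 addm0.
have lift v : Phi_mnm r v = 0%MM -> J 'X_[U + v] ->
    exists f a f0, [/\ [/\ P f, f = 'X_[U] * a + f0 & is_initial_monomial f (U + v)%MM],
      is_initial_monomial a v, forall m, a@_m != 0 -> Phi_mnm r m = 0%MM &
      forall m, f0@_m != 0 -> Phi_mnm r m <> U /\ ~ Q m].
  move=> v0 Jv; have [f1 Pf1 in1] := initial_ideal_lift P_ideal Jv.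
  have [f [Pf fin fQ]] := tail_reduction P_ideal QJ Pf1 in1 (QU _ v0).
  have [a [f0 [Ef ha h0]]] := split_at_block r U f.
  exists f, a, f0; split=> //.
  - apply: (initial_of_block (r := r) Ef _ _ _ fin) => [m /ha []//|m /h0 []//|].
    by rewrite Phi_mnmD PhiU v0 addm0.
  - move=> m /ha [E _]; move: E; rewrite Phi_mnmD PhiU -[X in _ = X]addm0.
    exact: addmI.
  - by move=> m /h0 [h1 /fQ].
have [g [ag [g0 [[Pg Eg gin] agin agt g0h]]]] := lift _ (Phil e) Je.
have [h [ah [h0 [[Ph Eh hin] ahin aht h0h]]]] := lift _ w0 Jw.
have [P0 PD PM] := P_ideal.
(* The multiples of U cancel in the difference, which leaves no monomial that could be
   the initial one. *)
have rel : ah * g = ag * h.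
  apply/eqP; rewrite -subr_eq0; apply: contraT => /initial_exists [m min].
  have PDf : P (ah * g - ag * h).
    by rewrite -mulNr; apply: PD; apply: PM.
  have Jmm := mem_initial_ideal PDf min.
  have DE : ah * g - ag * h = ah * g0 - ag * h0.
    by rewrite Eg Eh; ring.
  have /initialP [Dm _] := min; rewrite DE mcoeffB in Dm.
  have [mU nQ] : Phi_mnm r m <> U /\ ~ Q m.
    have aux (a b : S) : (forall m, a@_m != 0 -> Phi_mnm r m = 0%MM) ->
        (forall m, b@_m != 0 -> Phi_mnm r m <> U /\ ~ Q m) ->
        (a * b)@_m != 0 -> Phi_mnm r m <> U /\ ~ Q m.
      move=> ha hb /mcoeffM_neq0 [m1 [m2 [-> am1 /hb]]].
      by rewrite /Q Phi_mnmD (ha _ am1) add0m.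
    have [Z|/(aux _ _ aht g0h)//] := eqVneq (ah * g0)@_m 0.
    move: Dm; rewrite Z sub0r oppr_eq0; exact: aux agt h0h.
  by case: (JPhi Jmm).
have [N fN] := factorial_mpoly k n.
have [d [a' [b' [Eag Eah cop]]]] := gcd_cofactors fN ah (initial_neq0 agin).
have ag0 := initial_neq0 agin.
have d0 : d != 0 by apply: contraNneq ag0 => Z; rewrite Eag Z mul0r.
have a'0 : a' != 0 by apply: contraNneq ag0 => Z; rewrite Eag Z mulr0.
have b'0 : b' != 0 by apply: contraNneq (initial_neq0 ahin) => Z; rewrite Eah Z mulr0.
have [|q Eq] := cop g.
  exists h; apply: (mulfI d0); rewrite [RHS]mulrCA [h * _]mulrC -!Eag.
  by rewrite mulrA -Eah rel Eag -mulrA.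
have [pd ind] := initial_exists d0; have [pa ina] := initial_exists a'0.
have [pb inb] := initial_exists b'0.
have Ee : (U_(l) *+ e)%MM = (pd + pa)%MM.
  by apply: initial_unique agin _; rewrite Eag; apply: initialM.
have Ew : w = (pd + pb)%MM.
  by apply: initial_unique ahin _; rewrite Eah; apply: initialM.
have pdl : (U_(l) *+ pd l)%MM = pd.
  apply/mnmP => i; rewrite mulmnE mnm1E; have [->|ne] := eqVneq l i.
    by rewrite mul1n.
  move/mnmP: Ee => /(_ i); rewrite mulmnE mnm1E (negbTE ne) mnmDE.
  by case: (pd i).
have Pq : P q.
  have [//|Pa] : P q \/ P a' by apply: P_prime; rewrite -Eq.
  (* Otherwise J contains a power of 'X_l, whose truncation is the monomial 1. *)
  have Jpa := mem_initial_ideal Pa ina.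
  have pa0 : Phi_mnm r pa = 0%MM.
    move: (Phil e); rewrite Ee Phi_mnmD => /eqP.
    by rewrite mnmD_eq0 => /andP [_ /eqP].
  case: (JPhi Jpa); rewrite pa0; last by move=> E; case: U0.
  move=> J0; case: JU; apply: monomial_ideal_up J0 => //.
  by apply/mnm_lepP => i; rewrite mnm0E.
have q0 : q != 0.
  by apply: contraNneq (initial_neq0 gin) => Z; rewrite Eq Z mul0r.
have [pq inq] := initial_exists q0.
have Epq : pq = (U + pd)%MM.
  have : (U + U_(l) *+ e)%MM = (pq + pa)%MM.
    by apply: initial_unique gin _; rewrite Eq; apply: initialM.
  by rewrite Ee addmA => /addIm.
have := mem_initial_ideal Pq inq; rewrite Epq -pdl => /mine le.
by apply: leq_trans le _; rewrite Ew mnmDE leq_addr.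
Qed.

End Core.

(** * The generators of the initial ideal *)

Section Borel.
Variables (k : fieldType) (n r : nat) (r_lt_n : (r < n)%N).
Local Notation l := (Ordinal r_lt_n).

(** Exchange the variables beyond x_{r+1} for powers of x_{r+1}, one at a time: each
exchange lowers the total exponent of the variables beyond x_{r+1}. *)
Lemma borel_to_power (J : set {mpoly k[n]}) m : borel_type J -> J 'X_[m] ->
  exists N, J 'X_[Phi_mnm r m + U_(l) *+ N].
Proof.
move=> bJ.
move: {2}(\sum_(j < n | (r < j)%N) m j)%N
   (leqnn (\sum_(j < n | (r < j)%N) m j)%N) => s.
elim: s m => [|s IH] m les Jm.
  exists (m l); set m' := (_ + _)%MM; suff -> : m' = m by [].
  apply/mnmP => i; rewrite mnmDE Phi_mnmE mulmnE mnm1E -val_eqE /=.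
  case: (ltngtP i r) => ir; rewrite ?mul0n ?addn0 ?mul1n ?add0n //.
    move: les; rewrite leqn0 sum_nat_eq0 => /forallP /(_ i) /implyP /(_ ir) /eqP ->.
    by [].
  by congr (m _); apply/val_inj.
have [/existsP [j /andP [rj mj]]|none] := boolP [exists j : 'I_n, (r < j)%N && (0 < m j)%N].
  have [t Jt] := bJ l j m rj Jm mj.
  have [|N JN] := IH _ _ Jt.
    rewrite -ltnS; apply: leq_trans les.
    rewrite (bigD1 j) //= [in X in (_ < X)%N](bigD1 j) //=.
    have E (i : 'I_n) : (r < i)%N -> (m - U_(j) + U_(l) *+ t)%MM i = (m i - (j == i))%N.
      by move=> ri; rewrite mnmDE mnmBE mulmnE !mnm1E -[l == i]val_eqE /= ltn_eqF // mul0n addn0.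
    rewrite E // eqxx subn1 -addSn prednK // leq_add2l.
    rewrite leq_eqVlt; apply/orP; left; apply/eqP; apply: eq_bigr => i /andP [ri ij].
    by rewrite E // eq_sym (negbTE ij) subn0.
  exists N; suff -> : Phi_mnm r m = Phi_mnm r (m - U_(j) + U_(l) *+ t) by [].
  apply/mnmP => i; rewrite !Phi_mnmE; case: ltnP => // ir.
  rewrite mnmDE mnmBE mulmnE !mnm1E -!val_eqE /= [r == i]gtn_eqF // mul0n addn0.
  by rewrite gtn_eqF ?subn0 // (ltn_trans ir).
apply: IH Jm; rewrite big1 // => j rj; apply/eqP; rewrite -leqn0 leqNgt.
by apply/negP => mj; case/negP: none; apply/existsP; exists j; rewrite rj.
Qed.

End Borel.

Section Conclusion.
Variables (k : fieldType) (n r : nat) (r_lt_n : (r < n)%N).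
Variables (J : set {mpoly k[n]}) (v : 'X_{1..n}).
Local Notation S := {mpoly k[n]}.
Hypothesis J_monomial : monomial_ideal J.
Hypothesis Jv : J 'X_[v].
Hypothesis JPhiv : ~ J 'X_[Phi_mnm r v].
Hypothesis J_split : forall m, J 'X_[m] -> J 'X_[Phi_mnm r m] \/ (v <= m)%MM.

Lemma first_vars_Phi (m : 'X_{1..n}) : mnm_in_first_vars r m <-> Phi_mnm r m = m.
Proof.
split=> [h|<- i ri].
  by apply/mnmP => i; rewrite Phi_mnmE; case: ltnP => // /h.
by rewrite Phi_mnmE ltnNge ri.
Qed.

(** The intersection of J with k[x_1, ..., x_r] generates an ideal that monomials in the
first r variables generate, and such a monomial divides w only if it divides Phi_r(w). *)
Lemma subring_gen_Phi (w : 'X_{1..n}) : ideal_gen (J `&` first_vars_subring r) ('X_[w] : S) ->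
  J 'X_[Phi_mnm r w].
Proof.
move=> h; have {h} : ideal_gen [set ('X_[m] : S) | m in
    [set m | J 'X_[m] /\ Phi_mnm r m = m]] 'X_[w].
  move: h; apply: ideal_gen_le => [|f [Jf fr]]; first exact: ideal_gen_is_ideal.
  apply/monomial_idealP => m fm; exists m; last exact: lepm_refl.
  split; first by case: J_monomial => _; apply; first exact: Jf.
  by apply/first_vars_Phi; apply: fr; rewrite mcoeff_msupp.
move=> /monomial_idealP /(_ w); rewrite mcoeffX eqxx oner_neq0 => /(_ isT).
case=> m [Jm E] le; have [Jid _] := J_monomial.
by apply: (monomial_ideal_up Jid _ Jm); rewrite -E; apply: Phi_mnm_mono.
Qed.

Lemma generated_by_first_vars_and (A : set S) : A `<=` J -> A 'X_[v] ->
  (forall m, J 'X_[m] -> mnm_in_first_vars r m -> A 'X_[m]) -> J = ideal_gen A.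
Proof.
move=> AJ Av Ar; have [Jid Jm] := J_monomial.
apply/seteqP; split; last exact: ideal_gen_le.
move=> f Jf; have Aid := ideal_gen_is_ideal A.
apply: ideal_of_monomials => // m fm; have Jmm := Jm _ _ Jf fm.
case: (J_split Jmm) => [JP|le]; last first.
  by apply: monomial_ideal_up le _ => //; apply: ideal_gen_mem.
apply: (monomial_ideal_up Aid (Phi_mnm_le r m)); apply/ideal_gen_mem/Ar => //.
by move=> i ri; rewrite Phi_mnmE ltnNge ri.
Qed.

Lemma extra_generator_intro : extra_generator J r v.
Proof.
split; last by move=> /subring_gen_Phi.
apply: generated_by_first_vars_and; first by move=> f [[]//|->].
  by right.
move=> m Jm mr; left; split=> // m'.
by rewrite msuppX inE => /eqP ->.
Qed.

(** Two candidates divide each other: each is in J, hence a multiple of the other unless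
it is generated by the part of J in the first r variables. *)
Lemma extra_generator_unique w : extra_generator J r w -> w = v.
Proof.
move=> [EJ nw]; have [Jid Jm] := J_monomial.
have Jw : J 'X_[w] by rewrite EJ; apply: ideal_gen_mem; right.
have vw : (v <= w)%MM.
  case: (J_split Jw) => // JP; case: nw.
  apply: monomial_ideal_up (Phi_mnm_le r w) _; first exact: ideal_gen_is_ideal.
  apply: ideal_gen_mem; split=> // m'; rewrite msuppX inE => /eqP -> i ri.
  by rewrite Phi_mnmE ltnNge ri.
suff wv : (w <= v)%MM.
  apply/mnmP => i; apply/eqP; rewrite eqn_leq.
  by move/mnm_lepP: vw => ->; move/mnm_lepP: wv => ->.
have : ideal_gen [set ('X_[m] : S) | m in
    [set m | (J 'X_[m] /\ Phi_mnm r m = m) \/ m = w]] 'X_[v].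
  move: Jv; rewrite {1}EJ; apply: ideal_gen_le => [|f]; first exact: ideal_gen_is_ideal.
  case=> [[Jf fr]|->]; last by apply: ideal_gen_mem; exists w => //; right.
  apply/monomial_idealP => m fm; exists m; last exact: lepm_refl.
  left; split; first exact: Jm fm.
  by apply/first_vars_Phi; apply: fr; rewrite mcoeff_msupp.
move=> /monomial_idealP /(_ v); rewrite mcoeffX eqxx oner_neq0 => /(_ isT).
case=> m [[Jmm E]|->//] le; case: JPhiv.
by apply: (monomial_ideal_up Jid _ Jmm); rewrite -E; apply: Phi_mnm_mono.
Qed.

End Conclusion.

Theorem theorem4p1 (k : fieldType) (n : nat) (P J : set {mpoly k[n]})
    (r : nat) (u : 'X_{1..r})
    (k_infinite : infinite_set [set: k])
    (P_prime : prime_ideal P)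
    (P_homogeneous : homogeneous_ideal P)
    (J_def : J = initial_ideal P)
    (J_borel : borel_type J)
    (r_gt0 : (0 < r)%N) (r_lt_n : (r < n)%N)
    (u_colon : ideal_colon (Pi r J) (irrelevant_ideal k r) 'X_[u])
    (u_notin : ~ Pi r J 'X_[u])
    (Phibar_eq : Phibar r J = ideal_add (Pi r J) (ideal_gen [set 'X_[u]])) :
  [/\ (u = 0%MM /\ first_vars_ideal k n r `<=` J) \/
        (exists v : 'X_{1..n}, extra_generator J r v),
      u <> 0%MM ->
        exists2 e : nat, (0 < e)%N &
          forall v : 'X_{1..n}, extra_generator J r v <->
            v = (mnm_embed n u + U_(Ordinal r_lt_n) *+ e)%MM
    & u <> 0%MM ->
        exists2 A : set 'X_{1..n}, {in A, forall m, mnm_in_first_vars r.+1 m} &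
          J = ideal_gen [set 'X_[m] | m in A]].
Proof.
have [[P0 P1 Plin] Pprime] := P_prime.
rewrite in_setE in P0.
have P_ideal : is_ideal P.
  split=> // f g.
    by move=> Pf Pg; have := Plin 1 f g; rewrite mul1r !in_setE; apply.
  by move=> Pg; have := Plin f g 0; rewrite addr0 !in_setE; apply.
have PM f g : P (f * g) -> P f \/ P g.
  by have := Pprime f g; rewrite !in_setE => h /h /orP []; rewrite in_setE; [left|right].
have J_monomial : monomial_ideal J by rewrite J_def; apply: initial_ideal_monomial.
have [Jid Jm] := J_monomial.
pose U := mnm_embed n u; pose l := Ordinal r_lt_n.
have PhiU : Phi_mnm r U = U by apply: Phi_mnm_embed.
have JU : ~ J 'X_[U] by move=> h; apply: u_notin; apply/Pi_monomial.
have JUi (i : 'I_n) : (i < r)%N -> J 'X_[U + U_(i)].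
  move=> ir; have := u_colon 'X_(Ordinal ir).
  rewrite -mpolyXD => /(_ (ideal_gen_mem _))/Pi_monomial; rewrite mnm_embedD.
  have -> // : mnm_embed n U_(Ordinal ir) = U_(i)%MM.
    apply/mnmP => j; rewrite mnm1E; case: (ltnP j r) => jr.
      by rewrite mnm_embedE mnm1E -!val_eqE.
    by rewrite mnm_embed0E // -val_eqE /= ltn_eqF // (leq_trans ir jr).
  by apply=> //; exists (Ordinal ir).
have PhiJ_monomial : monomial_ideal (Phi r J).
  rewrite /Phi -(image_comp (@Phi_mnm n r) (fun m => 'X_[m])).
  exact: monomial_ideal_gen.
have PhiJP m : Phi r J 'X_[m] <-> exists2 m0, min_gens J m0 & (Phi_mnm r m0 <= m)%MM.
  rewrite /Phi -(image_comp (@Phi_mnm n r) (fun m => 'X_[m])); split.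
    move=> /monomial_idealP /(_ m); rewrite mcoeffX eqxx oner_neq0 => /(_ isT).
    by case=> _ [m0 h <-] le; exists m0.
  case=> m0 g0 le; apply/monomial_idealP => m'; rewrite mcoeffX.
  have [<- _|] := eqVneq m m'; last by rewrite eqxx.
  by exists (Phi_mnm r m0) => //; exists m0.
(* As u lies in the right-hand side of Phibar_eq, it is a multiple of the truncation of
   a generator of J. *)
have [N JN] : exists N, J 'X_[U + U_(l) *+ N].
  have : Phibar r J 'X_[u].
    rewrite Phibar_eq; exists 0; last first.
      by exists 'X_[u]; rewrite ?add0r //; apply: ideal_gen_mem.
    have [J0 _ _] := Jid; exists 0 => //.
    by rewrite /trunc_vars comp_mpoly0.
  move=> /(Pi_monomial r_lt_n _ PhiJ_monomial) /PhiJP [m0 [Jm0 _] le].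
  have [N JN] := borel_to_power r_lt_n J_borel Jm0; exists N.
  apply: monomial_ideal_up JN => //; apply/mnm_lepP => i.
  by rewrite !mnmDE leq_add2r; move/mnm_lepP: le.
(* A proper multiple of u in the first r variables is divisible by some u * x_i with
   i <= r, which is in J because u is in the colon ideal. *)
have JPhi m : J 'X_[m] -> J 'X_[Phi_mnm r m] \/ Phi_mnm r m = U.
  move=> Jmm; have : Phibar r J 'X_[mnm_restrict r_lt_n m].
    apply/Pi_monomial => //; rewrite mnm_restrictK; apply/PhiJP.
    have [m0 g0 le] := min_gens_below Jmm; exists m0 => //; exact: Phi_mnm_mono.
  rewrite Phibar_eq => -[f If [g Ig E]].
  have : f@_(mnm_restrict r_lt_n m) + g@_(mnm_restrict r_lt_n m) != 0.
    by rewrite -mcoeffD E mcoeffX eqxx oner_neq0.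
  have [->|fm _] := eqVneq f@_(mnm_restrict r_lt_n m) 0; last first.
    by left; have := Pi_supp r_lt_n J_monomial If fm; rewrite mnm_restrictK.
  rewrite add0r => gm.
  have {}Ig : ideal_gen [set ('X_[m] : {mpoly k[r]}) | m in [set u]] g.
    by rewrite image_set1.
  have [_ -> le] := (monomial_idealP _ _).1 Ig _ gm.
  have UP : (U <= Phi_mnm r m)%MM.
    by rewrite -(mnm_restrictK r_lt_n) -(submK le) mnm_embedD; apply: lem_addl.
  have [Z|ne] := eqVneq (Phi_mnm r m) U; first by right.
  left; have [i Ui] : exists i : 'I_n, (U i < Phi_mnm r m i)%N.
    apply: contrapT => h; case/eqP: ne; apply/mnmP => i; apply/eqP.
    rewrite eqn_leq; move/mnm_lepP: UP => ->; rewrite andbT leqNgt.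
    by apply/negP => lt; apply: h; exists i.
  have ir : (i < r)%N by move: Ui; rewrite Phi_mnmE; case: (ltnP i r).
  apply: monomial_ideal_up (JUi i ir) => //; apply/mnm_lepP => j.
  rewrite mnmDE mnm1E; have [<-|] := eqVneq i j; first by rewrite addn1.
  by rewrite addn0; move/mnm_lepP: UP.
have [Eu|/eqP neu] := eqVneq u 0%MM.
  split=> //; left; split=> //; apply: ideal_gen_le => // _ [i ir <-].
  have E : U = 0%MM.
    apply/mnmP => j; rewrite /U Eu mnm0E; case: (ltnP j r) => jr.
      by rewrite mnm_embedE mnm0E.
    by rewrite mnm_embed0E.
  by have := JUi i ir; rewrite E add0m.
have U0 : U <> 0%MM.
  move=> E; apply: neu; rewrite -(mnm_embedK r_lt_n u) -/U E.
  by apply/mnmP => i; rewrite mnmE !mnm0E.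
have exN : exists N, `[< J 'X_[U + U_(l) *+ N] >] by exists N; apply/asboolP.
case: (ex_minnP exN) => e /asboolP Je mine'.
have mine c : J 'X_[U + U_(l) *+ c] -> (e <= c)%N by move=> h; apply/mine'/asboolP.
pose v := (U + U_(l) *+ e)%MM.
have e0 : (0 < e)%N.
  by rewrite lt0n; apply: contra_notN JU => /eqP E; move: Je; rewrite E mulm0n addm0.
have Phiv : Phi_mnm r v = U.
  apply/mnmP => i; rewrite -[in RHS]PhiU !Phi_mnmE mnmDE mulmnE mnm1E -val_eqE /=.
  by case: ltnP => // ir; rewrite gtn_eqF // mul0n addn0.
have J_split m : J 'X_[m] -> J 'X_[Phi_mnm r m] \/ (v <= m)%MM.
  move=> Jmm; case: (JPhi _ Jmm) => [|E]; [by left | right].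
  have Em : m = (U + (m - U))%MM.
    by rewrite addmC submK // -E; apply: Phi_mnm_le.
  have w0 : Phi_mnm r (m - U) = 0%MM.
    apply: (@addmI _ U); rewrite addm0 -{1}PhiU -Phi_mnmD -Em //.
  have le : (e <= (m - U)%MM l)%N.
    rewrite J_def in JU JPhi Je mine Jmm.
    apply: (tail_multiple_of_minimal_power P_ideal PM PhiU JU JPhi U0 _ Je mine w0).
      by [].
    by rewrite -Em.
  rewrite Em; apply/mnm_lepP => i; rewrite !mnmDE leq_add2l mulmnE mnm1E.
  by have [<-|] := eqVneq l i; rewrite ?mul1n ?mul0n.
have JPhiv : ~ J 'X_[Phi_mnm r v] by rewrite Phiv.
have v_extra : extra_generator J r v by apply: extra_generator_intro.
split; first by right; exists v.
  move=> _; exists e => // w; split=> [|->//].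
  exact: extra_generator_unique.
move=> _; exists [set m | J 'X_[m] /\ mnm_in_first_vars r.+1 m].
  by move=> m /set_mem [].
apply: (generated_by_first_vars_and (v := v) J_monomial J_split) => [_ [m [h _] <-]//||m Jmm mr].
  exists v => //; split=> // i ri.
  rewrite mnmDE mnm_embed0E ?(ltnW ri) // mulmnE mnm1E -val_eqE /= ltn_eqF //.
by exists m => //; split=> // i ri; apply: mr; apply: ltnW.
Qed.
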